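(* Let $D_1,D_2\ge2$, let $\varrho$ be a density operator on $\mathbb{C}^{D_1}\otimes\mathbb{C}^{D_2}$, and let $\varrho_1=\mathrm{Tr}_2\,\varrho$, $\varrho_2=\mathrm{Tr}_1\,\varrho$. Then $$T_{\max}(\varrho)-T_{\min}(\varrho)\ \ge\ 1-T_{\min}(\varrho_1)-T_{\min}(\varrho_2).$$
   Context: For a density operator $\omega$ on a $d$-dimensional Hilbert space and an orthonormal basis $\{|j\rangle\}_{j=1}^d$, the distillable texture of $\omega$ in that basis is $T(\omega)=1-\langle f_1|\omega|f_1\rangle$ with $|f_1\rangle=\frac{1}{\sqrt d}\sum_{j=1}^d|j\rangle$. $T_{\max}(\omega)$ and $T_{\min}(\omega)$ are the maximum and minimum of $T(\omega)$ over all orthonormal bases of the $d$-dimensional space on which $\omega$ acts; equivalently $T_{\max}(\omega)=1-\lambda_{\min}(\omega)$ and $T_{\min}(\omega)=1-\lambda_{\max}(\omega)$, where $\lambda_{\min}(\omega),\lambda_{\max}(\omega)$ are the smallest and largest eigenvalues of $\omega$. *)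

(* Defs.v *)
From HB Require Import structures.
From mathcomp Require Import all_boot all_order all_algebra.
From mathcomp Require Import complex.
From mathcomp Require Import all_classical all_reals.

Set Implicit Arguments.
Unset Strict Implicit.
Unset Printing Implicit Defensive.
Import Order.TTheory GRing.Theory Num.Theory.
Local Open Scope classical_set_scope.
Local Open Scope ring_scope.
Local Open Scope sesquilinear_scope.
Local Open Scope complex_scope.

(* The Hilbert space is C^d with C = R[i]; kets are column vectors. *)

Definition braket (R : realType) (d : nat) (u v : 'cV[R[i]]_d) : R[i] :=
  (u ^t* *m v) 0 0.

(* On R[i], 0 <= z means that z is real and nonnegative. *)
Definition density_operator (R : realType) (d : nat) (w : 'M[R[i]]_d) : Prop :=
  [/\ w \is hermsymmx,
      forall v : 'cV[R[i]]_d, 0 <= braket v (w *m v)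
    & \tr w = 1].

(* An orthonormal family of d vectors of C^d automatically spans C^d. *)
Definition orthonormal_basis (R : realType) (d : nat)
    (e : 'I_d -> 'cV[R[i]]_d) : Prop :=
  forall j k, braket (e j) (e k) = (j == k)%:R.

Definition uniform_ket (R : realType) (d : nat)
    (e : 'I_d -> 'cV[R[i]]_d) : 'cV[R[i]]_d :=
  ((Num.sqrt d%:R : R)^-1)%:C *: \sum_(j < d) e j.

(* <f|w|f> is real when w is Hermitian; Re only turns it into an element
   of R. *)
Definition texture (R : realType) (d : nat) (w : 'M[R[i]]_d)
    (e : 'I_d -> 'cV[R[i]]_d) : R :=
  1 - complex.Re (braket (uniform_ket e) (w *m uniform_ket e)).

Definition textures (R : realType) (d : nat) (w : 'M[R[i]]_d) : set R :=
  [set texture w e | e in [set e | orthonormal_basis e]].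

(* The set of orthonormal bases is compact and nonempty and the texture is
   continuous in the basis, so sup and inf are a maximum and a minimum. *)
Definition Tmax (R : realType) (d : nat) (w : 'M[R[i]]_d) : R :=
  sup (textures w).

Definition Tmin (R : realType) (d : nat) (w : 'M[R[i]]_d) : R :=
  inf (textures w).

(* C^D1 (x) C^D2 is identified with C^(D1 * D2) through the bijection
   mxvec_index : 'I_D1 -> 'I_D2 -> 'I_(D1 * D2), which labels |i> (x) |j>. *)
Definition ptrace2 (R : realType) (D1 D2 : nat) (A : 'M[R[i]]_(D1 * D2)) :
    'M[R[i]]_D1 :=
  \matrix_(i, i') \sum_(j < D2) A (mxvec_index i j) (mxvec_index i' j).

Definition ptrace1 (R : realType) (D1 D2 : nat) (A : 'M[R[i]]_(D1 * D2)) :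
    'M[R[i]]_D2 :=
  \matrix_(j, j') \sum_(i < D1) A (mxvec_index i j) (mxvec_index i j').

(* Main.v *)
(* Every unit ket is the uniform ket of some orthonormal basis, so the textures
   of [w] are exactly the numbers [1 - <u|w|u>] with [u] a unit ket.  For unit
   kets [a], [b] and the projections P = |a><a|, Q = |b><b|, one has
     P (x) 1 + 1 (x) Q - 1 = P (x) Q - (1 - P) (x) (1 - Q).
   Taking the expectation in [rho], the left side gives
   [<a|rho_1|a> + <b|rho_2|b> - 1], while (1 - P) (x) (1 - Q) >= |v><v| for
   [v = a' (x) b'] with unit kets [a'] orthogonal to [a] and [b'] to [b].
   Optimising over [a] and [b] requires no eigenvectors. *)

Require Import Defs.
From mathcomp Require Import all_boot all_order all_algebra.
From mathcomp Require Import complex.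
From mathcomp Require Import all_classical all_reals.
From mathcomp Require Import ring lra.
Import Order.TTheory GRing.Theory Num.Theory.
Local Open Scope ring_scope.
Local Open Scope complex_scope.
Local Open Scope sesquilinear_scope.

Set Implicit Arguments.
Unset Strict Implicit.
Unset Printing Implicit Defensive.

(** * Orthonormal bases and unit kets *)

Lemma braketE (R : realType) d (u v : 'cV[R[i]]_d) :
  braket u v = \sum_k (u k 0)^* * v k 0.
Proof. by rewrite /braket !mxE; apply: eq_bigr => k _; rewrite !mxE. Qed.

Lemma braket_mulmxE (R : realType) d (u v : 'cV[R[i]]_d) (w : 'M_d) :
  braket u (w *m v) = \sum_k \sum_l (u k 0)^* * w k l * v l 0.
Proof.
rewrite braketE; apply: eq_bigr => k _; rewrite mxE mulr_sumr.
by apply: eq_bigr => l _; rewrite mulrA.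
Qed.

Definition basis_mx (R : realType) d (e : 'I_d -> 'cV[R[i]]_d) : 'M[R[i]]_d :=
  \matrix_(k, j) e j k 0.

Lemma basis_mx_delta (R : realType) d (e : 'I_d -> 'cV[R[i]]_d) j :
  basis_mx e *m delta_mx j 0 = e j.
Proof. by rewrite -colE; apply/colP => k; rewrite !mxE. Qed.

Lemma basis_mxP (R : realType) d (e : 'I_d -> 'cV[R[i]]_d) :
  orthonormal_basis e <-> (basis_mx e)^t* *m basis_mx e = 1%:M.
Proof.
have E j k : ((basis_mx e)^t* *m basis_mx e) j k = braket (e j) (e k).
  by rewrite braketE mxE; apply: eq_bigr => l _; rewrite !mxE.
split=> [eP|/matrixP eP j k]; first by apply/matrixP => j k; rewrite E eP mxE.
by rewrite -E eP mxE.
Qed.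

(** Trace invariance: with the unitary U = [basis_mx e], cyclicity moves U around [w], and the
    summands are the diagonal entries of the conjugate of [w] by U. *)
Lemma sum_braket_basis (R : realType) d (e : 'I_d -> 'cV[R[i]]_d) (w : 'M_d) :
  orthonormal_basis e -> \sum_j braket (e j) (w *m e j) = \tr w.
Proof.
move=> /basis_mxP eP.
rewrite -[w in RHS]mulmx1 -(mulmx1C eP) mulmxA mxtrace_mulC /mxtrace.
apply: eq_bigr => j _; rewrite braketE mxE; apply: eq_bigr => k _.
by rewrite !mxE; congr (_ * _); apply: eq_bigr => l _; rewrite mxE.
Qed.

Lemma braketZ (R : realType) d (c : R) (u : 'cV[R[i]]_d) :
  braket (c%:C *: u) (c%:C *: u) = (c ^+ 2)%:C * braket u u.
Proof.
rewrite !braketE mulr_sumr; apply: eq_bigr => k _.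
rewrite !mxE rmorphM mulrACA -[X in X * _ = _]/(c%:C^*%C * c%:C).
by rewrite conjc_real -rmorphM.
Qed.

(** Only the [d.+1] diagonal terms of the double sum survive, and the squared prefactor is their
    inverse, which is genuine because the dimension is nonzero. *)
Lemma uniform_ket_unit (R : realType) d (e : 'I_d.+1 -> 'cV[R[i]]_d.+1) :
  orthonormal_basis e -> braket (uniform_ket e) (uniform_ket e) = 1.
Proof.
move=> eP.
rewrite braketZ.
have -> : braket (\sum_j e j) (\sum_j e j) = d.+1%:R.
  transitivity (\sum_j \sum_k braket (e j) (e k)).
    rewrite braketE.
    transitivity (\sum_k \sum_i \sum_j (e i k 0)^* * e j k 0).
      by apply: eq_bigr => k _; rewrite !summxE rmorph_sum big_distrlr.
    rewrite exchange_big; apply: eq_bigr => i _ /=.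
    rewrite exchange_big; apply: eq_bigr => j _ /=.
    by rewrite braketE.
  under eq_bigr => j _.
    under eq_bigr => k _ do rewrite eP.
    rewrite (bigD1 j) //= eqxx big1 ?addr0; last first.
      by move=> k; rewrite eq_sym => /negbTE ->.
    over.
  by rewrite sumr_const card_ord.
rewrite exprVn sqr_sqrtr ?ler0n // fmorphV rmorph_nat mulVf //.
by rewrite pnatr_eq0.
Qed.

Lemma unit_ket_basis (R : realType) d (u : 'cV[R[i]]_d.+1) :
  braket u u = 1 -> exists2 e, orthonormal_basis e & e ord0 = u.
Proof.
move=> u1.
(* All rows equal the transpose of [u]; Gram-Schmidt completes even this rank-one matrix to a
   unitary one, and only row 0 has to be controlled. *)
pose A : 'M[R[i]]_d.+1 := \matrix_(i, j) u j 0.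
have rA : row ord0 A = u^T by apply/rowP => j; rewrite !mxE.
have := @row_schmidt_sub _ _ _ A ord0.
rewrite (big_pred1 ord0); last first.
  by move=> i /=; rewrite leqn0.
rewrite genmxE => /sub_rVP[c].
have := @form1_row_schmidt _ _ _ A ord0.
have /row_unitarymxP := @schmidt_unitarymx _ _ _ A (leqnn _).
set B := schmidt A => BU; rewrite rA => pos uE.
have := pos; rewrite uE linearZl_LR /= BU eqxx mulr1 => c0.
have : dotmx u^T u^T = 1.
  rewrite dotmxE !mxE -u1 braketE.
  by apply: eq_bigr => k _; rewrite !mxE mulrC.
rewrite uE linearZl_LR linearZr_LR /= BU eqxx mulr1.
(* Row 0 of [B] agrees with [u] up to the scalar [c]. Gram-Schmidt makes [c] nonnegative, which
   removes the phase, and the unit norms then force [c] = 1. *)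
rewrite geC0_conj // -expr2 => /eqP; rewrite sqrp_eq1 // => /eqP c1.
exists (fun j => (row j B)^T).
  move=> j k; have := BU k j; rewrite dotmxE !mxE eq_sym => <-.
  by rewrite braketE; apply: eq_bigr => l _; rewrite !mxE mulrC.
by rewrite -[u]trmxK uE c1 scale1r.
Qed.

Lemma delta_basis (R : realType) d :
  orthonormal_basis (fun j : 'I_d => delta_mx j 0 : 'cV[R[i]]_d).
Proof.
apply/basis_mxP; rewrite (_ : basis_mx _ = 1%:M) ?mulmx1 ?trmx1 ?map_mx1 //.
by apply/matrixP => i j; rewrite !mxE eqxx andbT.
Qed.

(** A unitary sending the uniform ket of the standard basis to [u] carries the standard basis to the
    one sought. Completing both kets to bases [f] and [e] yields this unitary, as the change of
    basis from [f] to [e]. *)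
Lemma unit_ket_uniform (R : realType) d (u : 'cV[R[i]]_d) :
  braket u u = 1 -> exists2 e, orthonormal_basis e & uniform_ket e = u.
Proof.
case: d u => [u|d u].
  by rewrite braketE big_ord0 => /esym/eqP; rewrite oner_eq0.
pose std (j : 'I_d.+1) : 'cV[R[i]]_d.+1 := delta_mx j 0.
have stdP : orthonormal_basis std := @delta_basis R d.+1.
move=> /unit_ket_basis[e eP <-].
have [f fP f0] := unit_ket_basis (uniform_ket_unit stdP).
move: (eP) (fP) => /basis_mxP eU /basis_mxP fU.
pose U := basis_mx e *m (basis_mx f)^t*.
exists (fun j => U *m std j).
  apply/basis_mxP.
  have -> : basis_mx (fun j => U *m std j) = U.
    by apply/matrixP => i j; rewrite mxE -colE mxE.
  rewrite /U trmx_mul map_mxM /= trmxCK mulmxA -(mulmxA (basis_mx f)) eU.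
  by rewrite mulmx1 mulmx1C.
rewrite /uniform_ket -mulmx_sumr scalemxAr -[_ *: _]/(uniform_ket std) -f0.
rewrite -basis_mx_delta -!mulmxA (mulmxA _ (basis_mx f)) fU mul1mx.
by rewrite basis_mx_delta.
Qed.

(** * Product kets and partial traces *)

Lemma sum_mxvec_index (V : nmodType) m n (F : 'I_(m * n) -> V) :
  \sum_k F k = \sum_i \sum_j F (mxvec_index i j).
Proof.
rewrite (reindex _ (curry_mxvec_bij _ _)) pair_bigA.
by apply: eq_bigr => -[].
Qed.

Definition tensor_ket (R : realType) m n (x : 'cV[R[i]]_m) (y : 'cV[R[i]]_n) :
  'cV[R[i]]_(m * n) := (mxvec (x *m y^T))^T.

Lemma tensor_ketE (R : realType) m n (x : 'cV[R[i]]_m) (y : 'cV[R[i]]_n) i j :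
  tensor_ket x y (mxvec_index i j) 0 = x i 0 * y j 0.
Proof. by rewrite mxE mxvecE mxE big_ord1 mxE. Qed.

Lemma braket_tensor (R : realType) m n (x x' : 'cV[R[i]]_m)
    (y y' : 'cV[R[i]]_n) :
  braket (tensor_ket x y) (tensor_ket x' y') = braket x x' * braket y y'.
Proof.
rewrite !braketE sum_mxvec_index big_distrlr; apply: eq_bigr => i _ /=.
by apply: eq_bigr => j _; rewrite !tensor_ketE rmorphM mulrACA.
Qed.

(** Compressing [rho] by [x] on the first factor leaves an operator [w] on the second. The left side
    is the trace of [w] in the basis [f]; the right side is the same trace in the standard basis. *)
Lemma sum_braket_ptrace2 (R : realType) m n (rho : 'M[R[i]]_(m * n))
    (x : 'cV[R[i]]_m) (f : 'I_n -> 'cV[R[i]]_n) :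
  orthonormal_basis f ->
  \sum_j braket (tensor_ket x (f j)) (rho *m tensor_ket x (f j)) =
  braket x (ptrace2 rho *m x).
Proof.
move=> fP; pose w : 'M[R[i]]_n := \matrix_(j, j') \sum_i \sum_i'
  (x i 0)^* * rho (mxvec_index i j) (mxvec_index i' j') * x i' 0.
transitivity (\tr w).
  rewrite -(sum_braket_basis _ fP); apply: eq_bigr => j _.
  rewrite !braket_mulmxE sum_mxvec_index exchange_big; apply: eq_bigr => k _ /=.
  transitivity (\sum_i \sum_l \sum_i' ((f j k 0)^* * ((x i 0)^* *
    rho (mxvec_index i k) (mxvec_index i' l) * x i' 0) * f j l 0)).
    apply: eq_bigr => i _; rewrite sum_mxvec_index exchange_big.
    apply: eq_bigr => l _; apply: eq_bigr => i' _ /=.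
    rewrite !tensor_ketE rmorphM; ring.
  rewrite exchange_big; apply: eq_bigr => l _ /=.
  rewrite mxE mulr_sumr mulr_suml; apply: eq_bigr => i _.
  by rewrite mulr_sumr mulr_suml.
rewrite braket_mulmxE /mxtrace.
under eq_bigr => j _ do rewrite mxE.
rewrite exchange_big; apply: eq_bigr => i _ /=.
rewrite exchange_big; apply: eq_bigr => i' _ /=.
by rewrite mxE mulr_sumr mulr_suml.
Qed.

Lemma sum_braket_ptrace1 (R : realType) m n (rho : 'M[R[i]]_(m * n))
    (y : 'cV[R[i]]_n) (e : 'I_m -> 'cV[R[i]]_m) :
  orthonormal_basis e ->
  \sum_i braket (tensor_ket (e i) y) (rho *m tensor_ket (e i) y) =
  braket y (ptrace1 rho *m y).
Proof.
move=> eP; pose w : 'M[R[i]]_m := \matrix_(i, i') \sum_j \sum_j'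
  (y j 0)^* * rho (mxvec_index i j) (mxvec_index i' j') * y j' 0.
transitivity (\tr w).
  rewrite -(sum_braket_basis _ eP); apply: eq_bigr => i _.
  rewrite !braket_mulmxE sum_mxvec_index; apply: eq_bigr => k _ /=.
  transitivity (\sum_j \sum_l \sum_j' ((e i k 0)^* * ((y j 0)^* *
    rho (mxvec_index k j) (mxvec_index l j') * y j' 0) * e i l 0)).
    apply: eq_bigr => j _; rewrite sum_mxvec_index.
    apply: eq_bigr => l _; apply: eq_bigr => j' _ /=.
    rewrite !tensor_ketE rmorphM; ring.
  rewrite exchange_big; apply: eq_bigr => l _ /=.
  rewrite mxE mulr_sumr mulr_suml; apply: eq_bigr => j _.
  by rewrite mulr_sumr mulr_suml.
rewrite braket_mulmxE /mxtrace.
under eq_bigr => i _ do rewrite mxE.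
rewrite exchange_big; apply: eq_bigr => j _ /=.
rewrite exchange_big; apply: eq_bigr => j' _ /=.
by rewrite mxE mulr_sumr mulr_suml.
Qed.

Lemma mxtrace_ptrace2 (R : realType) m n (rho : 'M[R[i]]_(m * n)) :
  \tr (ptrace2 rho) = \tr rho.
Proof.
by rewrite /mxtrace sum_mxvec_index; apply: eq_bigr => i _; rewrite mxE.
Qed.

(** * Textures and the inequality for the marginals *)

Lemma mem_textures (R : realType) d (w : 'M[R[i]]_d) u :
  braket u u = 1 -> textures w (1 - complex.Re (braket u (w *m u))).
Proof. by move=> /unit_ket_uniform[e eP <-]; exists e. Qed.

Lemma textures_neq0 (R : realType) d (w : 'M[R[i]]_d) :
  (textures w !=set0)%classic.
Proof. by eexists; eexists; [exact: delta_basis|]. Qed.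

(** In a basis containing the uniform ket, its expectation is one of several nonnegative terms with
    sum [\tr w] = 1. These bounds make [sup] and [inf] meaningful. *)
Lemma textures_bounded (R : realType) d (w : 'M[R[i]]_d) t :
  density_operator w -> textures w t -> 0 <= t <= 1.
Proof.
case: d w => [|d] w [_ w_ge0 w_tr].
  by move: w_tr; rewrite /mxtrace big_ord0 => /esym/eqP; rewrite oner_eq0.
move=> [e /uniform_ket_unit/unit_ket_basis[f fP f0] <-].
rewrite /texture -f0 subr_ge0 lerBlDr lerDl.
have := w_ge0 (f ord0); rewrite lecE => /andP[_ ->]; rewrite andbT.
have : braket (f ord0) (w *m f ord0) <= 1.
  rewrite -w_tr -(sum_braket_basis _ fP) (bigD1 ord0) //= lerDl.
  by apply: sumr_ge0.
by rewrite lecE => /andP[].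
Qed.

Lemma marginal_braket_le (R : realType) m n (rho : 'M[R[i]]_(m.+2 * n.+2))
    (a : 'cV[R[i]]_m.+2) (b : 'cV[R[i]]_n.+2) :
  density_operator rho -> braket a a = 1 -> braket b b = 1 ->
  exists u v, [/\ braket u u = 1, braket v v = 1 &
    complex.Re (braket a (ptrace2 rho *m a)) +
    complex.Re (braket b (ptrace1 rho *m b)) +
    complex.Re (braket v (rho *m v)) <=
    1 + complex.Re (braket u (rho *m u))].
Proof.
move=> [_ rho_ge0 rho_tr] /unit_ket_basis[e eP <-] /unit_ket_basis[f fP <-].
(* [p] is the joint distribution of measuring [rho] in the product basis; the two marginal
   expectations are its row and column sums at [ord0]. *)
pose p i j := braket (tensor_ket (e i) (f j)) (rho *m tensor_ket (e i) (f j)).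
have p_ge0 i j : 0 <= p i j by apply: rho_ge0.
have tensor_unit i j :
    braket (tensor_ket (e i) (f j)) (tensor_ket (e i) (f j)) = 1.
  by rewrite braket_tensor eP fP !eqxx mulr1.
exists (tensor_ket (e ord0) (f ord0)).
exists (tensor_ket (e (lift ord0 ord0)) (f (lift ord0 ord0))).
split=> //.
have trE : \sum_i \sum_j p i j = 1.
  rewrite -rho_tr -mxtrace_ptrace2 -(sum_braket_basis _ eP).
  by apply: eq_bigr => i _; apply: sum_braket_ptrace2.
(* The order on [R[i]] includes the order on real parts, so the estimate can be made on complex
   numbers. *)
suff : braket (e ord0) (ptrace2 rho *m e ord0) +
    braket (f ord0) (ptrace1 rho *m f ord0) +
    p (lift ord0 ord0) (lift ord0 ord0) <= 1 + p ord0 ord0.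
  by rewrite lecE => /andP[_]; rewrite !raddfD.
rewrite -(sum_braket_ptrace2 _ _ fP) -(sum_braket_ptrace1 _ _ eP) -/(p _ _).
rewrite -trE.
rewrite [\sum_i \sum_j p i j]big_ord_recl.
have -> : \sum_(i < m.+1) \sum_j p (lift ord0 i) j =
    \sum_(i < m.+1) p (lift ord0 i) ord0 +
    \sum_(i < m.+1) \sum_(j < n.+1) p (lift ord0 i) (lift ord0 j).
  by rewrite -big_split; apply: eq_bigr => i _; rewrite big_ord_recl.
rewrite [\sum_i p i ord0]big_ord_recl.
(* The total is X + Y + Z, while row 0 and column 0 together give X + c + Y, counting the corner [c]
   twice. What remains is that the block Z, off both, dominates its own first entry. *)
set X := \sum_j p ord0 j; set Y := \sum_(i < m.+1) p _ ord0.
set Z := \sum_i \sum_j _; set c := p ord0 ord0.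
suff : p (lift ord0 ord0) (lift ord0 ord0) <= Z.
  rewrite -(lerD2l (X + (c + Y))) => /le_trans; apply.
  by rewrite le_eqVlt; apply/orP; left; apply/eqP; ring.
rewrite /Z (bigD1 ord0) //= (bigD1 ord0) //= -addrA lerDl.
by rewrite addr_ge0 ?sumr_ge0 // => i _; rewrite sumr_ge0.
Qed.

Theorem mainTheorem9 (R : realType) (D1 D2 : nat) (hD1 : (2 <= D1)%N)
    (hD2 : (2 <= D2)%N) (rho : 'M[R[i]]_(D1 * D2))
    (hrho : density_operator rho) :
  Tmax rho - Tmin rho >= 1 - Tmin (ptrace2 rho) - Tmin (ptrace1 rho).
Proof.
case: D1 D2 hD1 hD2 rho hrho => [|[|m]] // [|[|n]] // _ _ rho hrho.
(* The bound is proved for every pair of marginal textures: [v] bounds [Tmax rho] from below and [u]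
   bounds [Tmin rho] from above. The two infima are then taken one after the other. *)
have key t1 t2 : textures (ptrace2 rho) t1 -> textures (ptrace1 rho) t2 ->
    1 - (Tmax rho - Tmin rho) - t1 <= t2.
  move=> [e /uniform_ket_unit a1 <-] [f /uniform_ket_unit b1 <-].
  have [u [v [u1 v1]]] := marginal_braket_le hrho a1 b1.
  have ubT : has_ubound (textures rho).
    by exists 1 => t /(textures_bounded hrho)/andP[].
  have lbT : has_lbound (textures rho).
    by exists 0 => t /(textures_bounded hrho)/andP[].
  have := ub_le_sup ubT (mem_textures rho v1).
  have := ge_inf lbT (mem_textures rho u1).
  by rewrite -/(Tmax rho) -/(Tmin rho) /texture; lra.
suff : 1 - (Tmax rho - Tmin rho) - Tmin (ptrace2 rho) <= Tmin (ptrace1 rho).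
  by lra.
apply: lb_le_inf => [|t2 t2P]; first exact: textures_neq0.
rewrite lerBlDr -lerBlDl.
apply: lb_le_inf => [|t1 t1P]; first exact: textures_neq0.
by rewrite lerBlDl -lerBlDr key.
Qed.
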